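(* Let $X\in\mathbb{R}^{m\times n}$. Then $\log\mathrm{vol}$ is a set submodular function on column submatrices of $X$; that is, for all $\mathcal{S}\subset\mathcal{T}\subset\{1,\ldots,n\}$ and all $t\in\{1,\ldots,n\}-\mathcal{T}$, $$\log\mathrm{vol}(X_{\mathcal{T}\cup\{t\}})-\log\mathrm{vol}(X_{\mathcal{T}})\le \log\mathrm{vol}(X_{\mathcal{S}\cup\{t\}})-\log\mathrm{vol}(X_{\mathcal{S}}).$$
   Context: For $\mathcal{S}\subset\{1,\ldots,n\}$, $X_{\mathcal{S}}$ is the submatrix of $X$ consisting of the columns indexed by $\mathcal{S}$, and $\mathrm{vol}(X_{\mathcal{S}})=\sqrt{\det(X_{\mathcal{S}}^TX_{\mathcal{S}})}$ (the product of the singular values if $X_{\mathcal{S}}$ has full column rank, and $0$ otherwise); the volume of the empty matrix is $1$. Differences of logarithms are logarithms of ratios of volumes, with the conventions $0/0=0$ and $\log 0=-\infty$; that is, the inequality means $\mathrm{vol}(X_{\mathcal{T}\cup\{t\}})/\mathrm{vol}(X_{\mathcal{T}})\le \mathrm{vol}(X_{\mathcal{S}\cup\{t\}})/\mathrm{vol}(X_{\mathcal{S}})$ with $0/0=0$. *)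

(* Defs.v *)
From mathcomp Require Import all_boot all_order all_algebra.
From mathcomp Require Import all_classical all_reals all_analysis.
Set Implicit Arguments.
Unset Strict Implicit.
Unset Printing Implicit Defensive.
Import Order.TTheory GRing.Theory Num.Theory.
Local Open Scope ring_scope.

Definition col_submx (R : realType) (m n : nat) (X : 'M[R]_(m, n))
    (S : {set 'I_n}) : 'M[R]_(m, #|S|) :=
  \matrix_(i < m, j < #|S|) X i (enum_val j).

Definition vol (R : realType) (m k : nat) (A : 'M[R]_(m, k)) : R :=
  Num.sqrt (\det (A^T *m A)).

Lemma vol_empty (R : realType) (m : nat) (A : 'M[R]_(m, 0)) : vol A = 1.
Proof. by rewrite /vol det_mx00 sqrtr1. Qed.

(* [lne] is the extended logarithm, with log 0 = -oo. *)
Definition logvol (R : realType) (m k : nat) (A : 'M[R]_(m, k)) : \bar R :=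
  lne (vol A)%:E.

(* In \bar R, -oo - -oo = -oo, which is the convention log 0 - log 0 =
   log (0 / 0) = log 0 = -oo; see [lneB_ratio]. *)
Definition set_submodular (R : realType) (n : nat)
    (f : {set 'I_n} -> \bar R) : Prop :=
  forall (S T : {set 'I_n}) (t : 'I_n), S \subset T -> t \notin T ->
    (f (T :|: [set t]) - f T <= f (S :|: [set t]) - f S)%E.

Lemma lneB_ratio (R : realType) (a b : R) :
  0 <= a -> 0 <= b -> (b = 0 -> a = 0) ->
  (lne a%:E - lne b%:E = lne (a / b)%:E)%E.
Proof.
rewrite !le0r => /orP[/eqP -> _ _|a0 /orP[/eqP ->|b0] ba].
- by rewrite mul0r le0_lneNy// addNye.
- by move: a0; rewrite (ba erefl) ltxx.
- by rewrite !lne_EFin ?divr_gt0// ln_div ?posrE.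
Qed.

(* Main.v *)
Require Import Defs.
From mathcomp Require Import all_boot all_order all_algebra.
From mathcomp Require Import all_classical all_reals all_analysis.
From mathcomp Require Import perm.

(** Appending a column [v] to a matrix [A] multiplies the volume by the
    Euclidean distance from [v] to the column space of [A]: the volume of a
    parallelepiped is that of its base times its height ([vol_row_mx]).  The
    volume ratio attached to adding the column [t] to [S] is therefore the
    distance from that column to the span of the columns in [S].  A distance to
    a subspace can only decrease when the subspace grows ([vol_residual_le]),
    which is the inequality for [S] and [T] once both volumes are nonzero.

    The degenerate case is settled by monotonicity of vanishing: by the same
    height formula a zero volume stays zero when columns are added
    ([vol_col_submx_eq0]).  Hence if the columns in [S] are dependent, so are
    those in [T], and when [T] has volume zero the ratio on its side is
    [0 / 0 = 0], below any ratio of volumes.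

    The height is never introduced as an infimum.  It is the norm of a residual
    [v - A c], where [c] solves the normal equation [A^T (v - A c) = 0]; such a
    [c] exists for every [A], of full column rank or not ([normal_equation]),
    and the norm of a column [w] is just [vol w]. *)

Import Order.TTheory GRing.Theory Num.Theory.
Local Open Scope ring_scope.

(** * Heights and volumes *)

Lemma trmx_mul_eq0 {R : realType} {m k : nat} (M : 'M[R]_(m, k)) :
  M^T *m M = 0 -> M = 0.
Proof.
move=> M0; apply/matrixP => i j; rewrite mxE; apply/eqP.
have sum0 : \sum_i M i j ^+ 2 = 0.
  transitivity ((M^T *m M) j j); last by rewrite M0 mxE.
  by rewrite mxE; apply: eq_bigr => l _; rewrite mxE expr2.
have sq_ge0 l : true -> 0 <= M l j ^+ 2 by rewrite sqr_ge0.
by rewrite -sqrf_eq0; apply/eqP; exact: (psumr_eq0P sq_ge0 sum0).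
Qed.

(** The row spaces of [A] and [A^T A] coincide: if [B] is a matrix killed by
    [A^T A], then [(A B)^T (A B) = 0], so that [A B = 0].  Since [v^T A] lies
    in the row space of [A], it is a combination of the rows of [A^T A]. *)
Lemma normal_equation {R : realType} {m k : nat} (A : 'M[R]_(m, k))
    (v : 'cV[R]_m) :
  exists c : 'cV[R]_k, A^T *m (v - A *m c) = 0.
Proof.
have sA : (A <= A^T *m A)%MS.
  rewrite submxE; apply/eqP/trmx_mul_eq0.
  by rewrite trmx_mul -mulmxA (mulmxA _ A) mulmx_coker mulmx0.
have /submxP[d vAd] := submx_trans (submxMl v^T A) sA.
exists d^T; rewrite mulmxBr mulmxA.
by rewrite -[A^T *m v]trmxK trmx_mul trmxK vAd !trmx_mul trmxK subrr.
Qed.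

Lemma vol_mulmx {R : realType} {m k : nat} (A : 'M[R]_(m, k)) (P : 'M[R]_k) :
  \det P ^+ 2 = 1 -> vol (A *m P) = vol A.
Proof.
move=> detP; rewrite /vol trmx_mul -mulmxA (mulmxA A^T) !det_mulmx det_tr.
by rewrite mulrCA -expr2 detP mulr1.
Qed.

Lemma sqnorm_ge0 {R : realType} {m : nat} (w : 'cV[R]_m) :
  0 <= (w^T *m w) 0 0.
Proof. by rewrite mxE sumr_ge0// => i _; rewrite mxE -expr2 sqr_ge0. Qed.

(** Replacing [v] by the residual [w = v - A c] is a shear, which preserves
    volume; as [w] is orthogonal to the columns of [A], the Gram matrix of
    [A | w] is block diagonal. *)
Lemma vol_row_mx {R : realType} {m k : nat} {A : 'M[R]_(m, k)} {v : 'cV[R]_m}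
    {c : 'cV[R]_k} :
  A^T *m (v - A *m c) = 0 ->
  vol (row_mx A v) = vol A * vol (v - A *m c).
Proof.
set w := v - A *m c => Aw.
have -> : row_mx A v = row_mx A w *m block_mx 1%:M c 0 1%:M.
  by rewrite mul_row_block mulmx1 mulmx0 addr0 mulmx1 addrC subrK.
rewrite vol_mulmx ?det_ublock ?det1 ?mulr1 ?expr1n// /vol.
have wA : w^T *m A = 0 by rewrite -[A in LHS]trmxK -trmx_mul Aw trmx0.
rewrite tr_row_mx mul_col_row Aw wA det_ublock [X in _ * X]det_mx11.
by rewrite mulrC sqrtrM ?sqnorm_ge0// mulrC [in RHS]det_mx11.
Qed.

(** The distance to the larger space is the smaller one.  The difference of the
    two residuals lies in the column space of [B], hence is orthogonal to the
    residual [v - B d], and Pythagoras applies.  The coefficients [c] are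
    arbitrary. *)
Lemma vol_residual_le {R : realType} {m k l : nat} (A : 'M[R]_(m, k))
    (B : 'M[R]_(m, l)) (v : 'cV[R]_m) (c : 'cV[R]_k) (d : 'cV[R]_l) :
  (A^T <= B^T)%MS -> B^T *m (v - B *m d) = 0 ->
  vol (v - B *m d) <= vol (v - A *m c).
Proof.
move=> /submxP[E AE] wB; set w := v - B *m d in wB *.
have {}AE : A = B *m E^T by rewrite -[A]trmxK AE trmx_mul trmxK.
pose u := B *m (d - E^T *m c).
have -> : v - A *m c = w + u.
  by rewrite /u mulmxBr mulmxA -AE addrA subrK.
have uw : u^T *m w = 0 by rewrite trmx_mul -mulmxA wB mulmx0.
have wu : w^T *m u = 0 by rewrite -[u]trmxK -trmx_mul uw trmx0.
clearbody w u; rewrite /vol ler_wsqrtr// !det_mx11 [(w + u)^T]linearD /= mulmxDl !mulmxDr uw wu.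
by rewrite addr0 add0r [leRHS]mxE lerDl sqnorm_ge0.
Qed.

(** * Volumes of column submatrices *)

(** Volume does not depend on the order in which the columns are listed, so any
    injective enumeration of [S] may replace the one built into [col_submx]. *)
Lemma vol_colsub {R : realType} {m n k : nat} (X : 'M[R]_(m, n))
    (S : {set 'I_n}) (f : 'I_k -> 'I_n) :
  injective f -> #|S| = k -> (forall i, f i \in S) ->
  vol (colsub f X) = vol (col_submx X S).
Proof.
move=> f_inj Sk; case: k / Sk f f_inj => f f_inj fS.
pose g i := enum_rank_in (fS i) (f i).
have fg i : enum_val (g i) = f i by rewrite enum_rankK_in.
have g_inj : injective g by move=> i j /(congr1 enum_val); rewrite !fg => /f_inj.
have -> : colsub f X = col_perm (perm g_inj) (col_submx X S).
  by apply/matrixP => i j; rewrite !mxE permE fg.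
by rewrite col_permE vol_mulmx// det_perm sqrr_sign.
Qed.

Lemma vol_col_submxU1 {R : realType} {m n : nat} (X : 'M[R]_(m, n))
    (S : {set 'I_n}) (t : 'I_n) : t \notin S ->
  vol (col_submx X (S :|: [set t])) = vol (row_mx (col_submx X S) (col t X)).
Proof.
move=> tS.
pose f (i : 'I_(#|S| + 1)) := if fintype.split i is inl j then enum_val j else t.
rewrite -(vol_colsub X (S :|: [set t]) f).
- congr vol; apply/matrixP => i j; rewrite !mxE /f.
  by case: (fintype.split j) => l; rewrite mxE.
- move=> i j; rewrite /f => e; apply: (can_inj (@fintype.splitK _ _)); move: e.
  case: (fintype.split i) => a; case: (fintype.split j) => b.
  + by move/enum_val_inj ->.
  + by move=> e; move: tS; rewrite -e enum_valP.
  + by move=> e; move: tS; rewrite e enum_valP.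
  + by rewrite (ord1 a) (ord1 b).
- by rewrite finset.setUC cardsU1 tS addnC.
- move=> i; rewrite /f !inE; case: (fintype.split i) => a; last by rewrite eqxx orbT.
  by rewrite enum_valP.
Qed.

Lemma col_submxS {R : realType} {m n : nat} (X : 'M[R]_(m, n))
    (S T : {set 'I_n}) :
  S \subset T -> ((col_submx X S)^T <= (col_submx X T)^T)%MS.
Proof.
move=> /fintype.subsetP ST; apply/row_subP => i.
have iT := ST _ (enum_valP i).
rewrite (_ : row i _ = row (enum_rank_in iT (enum_val i)) (col_submx X T)^T).
  exact: row_sub.
by apply/rowP => j; rewrite !mxE enum_rankK_in.
Qed.

(** No hypothesis on [t] is made, so that columns may be added one by one
    without tracking repetitions. *)
Lemma vol_col_submxU1_eq0 {R : realType} {m n : nat} (X : 'M[R]_(m, n))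
    (S : {set 'I_n}) (t : 'I_n) :
  vol (col_submx X S) = 0 -> vol (col_submx X (S :|: [set t])) = 0.
Proof.
move=> S0; have [tS|tS] := boolP (t \in S).
  by rewrite (finset.setUidPl _)// finset.sub1set.
have [c /vol_row_mx vc] := normal_equation (col_submx X S) (col t X).
by rewrite vol_col_submxU1// vc S0 mul0r.
Qed.

Lemma vol_col_submx_eq0 {R : realType} {m n : nat} (X : 'M[R]_(m, n))
    (S T : {set 'I_n}) : S \subset T ->
  vol (col_submx X S) = 0 -> vol (col_submx X T) = 0.
Proof.
move=> /finset.setUidPr <- S0; rewrite -(set_enum T).
elim: (enum T) => [|t s IHs]; first by rewrite finset.set_nil finset.setU0.
rewrite set_cons finset.setUC -finset.setUA finset.setUC [_ :|: S]finset.setUC.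
exact: vol_col_submxU1_eq0.
Qed.

Theorem theorem3p8 (R : realType) (m n : nat) (X : 'M[R]_(m, n)) :
  set_submodular (fun S : {set 'I_n} => logvol (col_submx X S)).
Proof.
move=> S T t ST tT.
have tS : t \notin S by apply: contra tT; exact: (fintype.subsetP ST).
have vol_ge0 k (A : 'M[R]_(m, k)) : 0 <= vol A by exact: sqrtr_ge0.
rewrite /logvol !lneB_ratio//; try exact: vol_col_submxU1_eq0.
rewrite lee_lne ?in_itv /= ?leey ?andbT ?lee_fin ?divr_ge0//.
have [T0|T_neq0] := eqVneq (vol (col_submx X T)) 0.
  by rewrite T0 invr0 mulr0 divr_ge0.
have S_neq0 : vol (col_submx X S) != 0.
  by apply: contra_neq T_neq0; exact: vol_col_submx_eq0.
have [c wS] := normal_equation (col_submx X S) (col t X).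
have [d wT] := normal_equation (col_submx X T) (col t X).
rewrite !vol_col_submxU1// (vol_row_mx wS) (vol_row_mx wT).
rewrite 2!(mulrAC _ _ _^-1) !divff// !mul1r.
by apply: vol_residual_le => //; exact: col_submxS.
Qed.
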